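(* If there exists a coanalytic set $E\subseteq 2^\omega$ of cardinality $\omega_1$, then there is a normalized unconditional basis $\mathcal{B}$ of a Banach space such that $\mathcal{RK}(\mathcal{B})\sim[\omega_1]^{<\omega}$.
   Context: An infinite countable set $\mathcal{B}$ of non-zero vectors of a (real) Banach space $X$ is an unconditional basic sequence if there exists $C>0$ such that for all finite sets $G\subseteq F\subseteq\mathcal{B}$ and every $\alpha:F\to\mathbb{R}$ we have $\|\sum_{x\in G}\alpha(x)x\|\le C\|\sum_{x\in F}\alpha(x)x\|$. It is an unconditional basis of $X$ if in addition its closed linear span is $X$. It is normalized if all its vectors have norm one. $\mathcal{RK}(\mathcal{B})$ is the family of all subsets of $\mathcal{B}$ which are relatively weakly compact in $X$, ordered by inclusion. $[\omega_1]^{<\omega}$ is the family of all finite subsets of $\omega_1$, ordered by inclusion. For partially ordered sets $P,Q$, a function $f:P\to Q$ is a Tukey function if for every $q_0\in Q$ there is $p_0\in P$ such that, for every $p\in P$, $f(p)\le q_0$ implies $p\le p_0$. Write $P\preceq Q$ if there is a Tukey function $P\to Q$, and $P\sim Q$ if $P\preceq Q$ and $Q\preceq P$. *)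

(* Defs.v *)
From HB Require Import structures.
From mathcomp Require Import all_boot all_order all_algebra finmap.
From mathcomp Require Import wochoice.
From mathcomp Require Import all_classical all_reals all_analysis.

Set Implicit Arguments.
Unset Strict Implicit.
Unset Printing Implicit Defensive.

Import Order.TTheory GRing.Theory Num.Theory.
Import numFieldNormedType.Exports.

Local Open Scope classical_set_scope.
Local Open Scope ring_scope.

Definition tukey_function {d d'} {P : porderType d} {Q : porderType d'}
    (f : P -> Q) : Prop :=
  forall q0 : Q, exists p0 : P, forall p : P, (f p <= q0)%O -> (p <= p0)%O.

Definition tukey_le {d d'} (P : porderType d) (Q : porderType d') : Prop :=
  exists f : P -> Q, tukey_function f.

Definition tukey_equiv {d d'} (P : porderType d) (Q : porderType d') : Prop :=
  tukey_le P Q /\ tukey_le Q P.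

(* The alias carries the order induced by the library order on [set T], which
   is inclusion. *)
Definition family_poset {T : Type} (F : set (set T)) : Type := set_type F.

HB.instance Definition _ (T : Type) (F : set (set T)) :=
  SubChoice.on (family_poset F).
HB.instance Definition _ (T : Type) (F : set (set T)) :=
  [SubChoice_isSubPOrder of family_poset F by <: with set_display].

Lemma family_poset_leE (T : Type) (F : set (set T)) (A B : family_poset F) :
  (A <= B)%O <-> val A `<=` val B.
Proof. by rewrite -Order.le_val -subsetEset. Qed.

Definition finite_subsets (T : Type) : set (set T) := [set A | finite_set A].

(* A well-ordering of the power set of [nat]; its elements with countably many
   predecessors form an initial segment of order type omega_1: see [omega1_le_wo],
   [omega1_le_countable] and [omega1_uncountable]. *)
Definition powerset_le : rel (set nat) := sval (well_ordering_principle (set nat)).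

Lemma powerset_le_wo : well_order powerset_le.
Proof. exact: svalP (well_ordering_principle (set nat)). Qed.

Definition omega1 : Type :=
  set_type [set x : set nat | countable [set y | powerset_le y x]].

Definition omega1_le : rel omega1 := relpre val powerset_le.

Lemma powerset_le_wo_chain : wo_chain powerset_le predT.
Proof. exact: withinW powerset_le_wo. Qed.

Lemma powerset_le_refl x : powerset_le x x.
Proof. exact: (wo_chain_reflexive powerset_le_wo_chain). Qed.

Lemma powerset_le_total x y : powerset_le x y || powerset_le y x.
Proof. exact: (wo_chainW powerset_le_wo_chain). Qed.

Lemma powerset_le_anti x y : powerset_le x y -> powerset_le y x -> x = y.
Proof.
move=> xy yx.
by apply: (wo_chain_antisymmetric powerset_le_wo_chain) => //; apply/andP.
Qed.

Lemma powerset_le_trans y x z :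
  powerset_le x y -> powerset_le y z -> powerset_le x z.
Proof.
move=> xy yz.
have [|w [[wA wmin] _]] := @powerset_le_wo (mem [:: x; y; z]).
  by exists x; rewrite inE eqxx.
have wx : powerset_le w x by apply: wmin; rewrite !inE eqxx.
have wy : powerset_le w y by apply: wmin; rewrite !inE eqxx orbT.
have wz : powerset_le w z by apply: wmin; rewrite !inE eqxx !orbT.
move: wA; rewrite !inE => /or3P[] /eqP we; subst w => //.
  by have -> : x = y by exact: powerset_le_anti.
have yE : y = z by exact: powerset_le_anti.
by rewrite -yE.
Qed.

Lemma omega1_le_wo : well_order omega1_le.
Proof.
apply: antisymmetric_well_order.
  by move=> x y /andP[xy yx]; apply: val_inj; exact: powerset_le_anti.
move=> A [a aA].
have [|w [[wB wmin] _]] := @powerset_le_wo [pred x | x \in val @` [set` A]].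
  by exists (val a); rewrite !inE; exists a.
move: wB; rewrite !inE => -[b bA bw]; exists b; split => // c cA.
by rewrite /omega1_le /= bw; apply: wmin; rewrite !inE; exists c.
Qed.

Lemma omega1_le_countable (x : omega1) : countable [set y | omega1_le y x].
Proof.
have /countable_injP[f finj] : countable [set y | powerset_le y (val x)].
  exact: set_valP x.
apply/countable_injP; exists (f \o val) => y z; rewrite !inE => yx zx /= fyz.
by apply: val_inj; apply: finj; rewrite ?inE.
Qed.

Lemma omega1_uncountable : ~ countable [set: omega1].
Proof.
set S := [set x : set nat | countable [set y | powerset_le y x]].
move=> co; have cS : countable S.
  have -> : S = [set val x | x in [set: omega1]].
    apply/seteqP; split=> [x Sx|x [y _ <-]]; last exact: set_valP y.
    have xS : x \in S by rewrite inE.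
    by exists (exist _ x xS : omega1).
  exact: card_le_trans (card_image_le _ _) co.
have [x xS] : exists x, x \notin S.
  apply: contrapT => nS; have ST : S = setT.
    apply/seteqP; split=> // x _; apply: contrapT => Sx; apply: nS.
    by exists x; rewrite notin_setE.
  move: cS; rewrite ST => /countable_injP[f finj].
  pose D := [set n | exists2 A : set nat, f A = n & ~ A n].
  have nD : ~ D (f D).
    move=> DfD; case: (DfD) => A fAD; apply.
    by have -> : A = D by apply: finj; rewrite ?inE.
  by apply: (nD); exists D.
have [|w [[wS wmin] _]] := @powerset_le_wo [pred x | x \notin S]; first by exists x.
move: wS; rewrite inE notin_setE; apply; rewrite /S /=.
have [f finj] := countable_injP _ cS.
apply/countable_injP; exists (fun y => if y == w then 0 else (f y).+1)%N.
have Slt y : powerset_le y w -> y != w -> S y.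
  move=> yw /eqP yNw; apply: contrapT => Sy; apply: yNw.
  apply: powerset_le_anti => //; apply: wmin.
  by rewrite inE notin_setE.
move=> y z; rewrite !inE /= => yw zw.
have [->|yNw] := eqVneq y w; have [->|zNw] := eqVneq z w => // -[fyz].
by apply: finj; rewrite ?inE //; exact: Slt.
Qed.

Definition baire_space : Type := prod_topology (fun _ : nat => nat).
HB.instance Definition _ := Topological.on baire_space.

Definition analytic_set {T : topologicalType} (A : set T) : Prop :=
  A = set0 \/ exists2 f : baire_space -> T, continuous f & range f = A.

Definition coanalytic_set {T : topologicalType} (A : set T) : Prop :=
  analytic_set (~` A).

Section banach.
Context {R : realType} (X : completeNormedModType R).

Definition topological_dual : Type :=
  set_type [set f : {linear X -> R^o} | continuous f].

(* The initial topology of the evaluation map into the product R^(X^* ) is the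
   coarsest one making every element of the topological dual continuous. *)
Definition weak_space : Type :=
  initial_topology (fun x : X =>
    (fun f : topological_dual => val f x) : prod_topology (fun=> R^o)).
HB.instance Definition _ := Topological.on weak_space.

Definition relatively_weakly_compact (A : set X) : Prop :=
  precompact (A : set weak_space).

Definition RK (B : set X) : set (set X) :=
  [set A | A `<=` B /\ relatively_weakly_compact A].

Definition linear_span (B : set X) : set X :=
  [set v | exists (F : {fset X}) (a : X -> R),
    [set` F] `<=` B /\ v = \sum_(x <- F) a x *: x].

Definition unconditional_basic_sequence (B : set X) : Prop :=
  [/\ infinite_set B, countable B, (forall x, B x -> x != 0) &
      exists2 C : R, 0 < C &
        forall (F G : {fset X}) (a : X -> R),
          [set` G] `<=` [set` F] -> [set` F] `<=` B ->
          `|\sum_(x <- G) a x *: x| <= C * `|\sum_(x <- F) a x *: x| ].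

Definition unconditional_basis (B : set X) : Prop :=
  unconditional_basic_sequence B /\ closure (linear_span B) = [set: X].

Definition normalized (B : set X) : Prop := forall x, B x -> `|x| = 1.

End banach.

(* Main.v *)
From HB Require Import structures.
Require Import Defs.
From mathcomp Require Import all_boot all_order all_algebra finmap.
From mathcomp Require Import ring lra.
From mathcomp Require Import all_classical all_reals all_analysis.

Set Implicit Arguments.
Unset Strict Implicit.
Unset Printing Implicit Defensive.

Import Order.TTheory GRing.Theory Num.Theory.
Import numFieldNormedType.Exports.

Local Open Scope classical_set_scope.
Local Open Scope ring_scope.

(** The basis is indexed by the nodes of the binary tree [seq bool]; write [b_x]
    for the branch of nodes that are initial segments of [x].  Given a hereditary
    family [A] of sets of nodes, the space is the completion of the finitely
    supported vectors under the norm [sup_(D in A) \sum_(s in D) |a s|].  This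
    norm only sees absolute values, so the unit vectors are an unconditional
    basis.  A set [S] of unit vectors containing an infinite member of [A] is not
    relatively weakly compact, since it contains a copy of the basis of l_1
    ([not_relatively_weakly_compact]), and [S] is relatively weakly compact once
    every functional tends to zero along it ([weakly_null_relatively_compact]).

    The family is chosen so that the relatively weakly compact sets are exactly
    the sets covered, up to finitely many nodes, by finitely many branches [b_x]
    with [x] in the coanalytic set [E].  All antichains are put in [A]: a set of
    nodes without infinite antichain is almost covered by finitely many branches
    ([antichain_free_covered]).  To spoil the branches outside [E], write the
    complement of [E] as a continuous image [f @` Z] of a closed subset of the
    Baire space, and add to [A] all subsets of
    [{f(t)|c_0, f(t)|c_1, ...}] with [t] in [Z] and [c] increasing above [t].
    Any infinite subset of [b_x] with [x = f t] contains an infinite set of this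
    kind ([branch_infinite_coded]).

    It remains to see that [b_x] is weakly null for [x] in [E].  As [c] bounds [t],
    a member of [A] inside [b_x] starts at a level that leaves only finitely many
    choices for the first coordinate of [t]; after removing that level, what is
    left belongs to the analogous family with one coordinate of [t] fixed.  If each
    of these families has convex combinations of unit vectors of arbitrarily small
    norm, then so has the original one, by averaging vectors with successive
    supports ([null_family_step]).  So, if the original family had no small convex
    combinations, one could fix the coordinates of [t] one after the other forever,
    and the resulting [t] would satisfy [f t = x] ([trace_family_null]).  This is a
    form of the lemma of Ptak by recursion on a well-founded tree, and it avoids
    any description of the dual space.

    Since [E] has cardinality omega_1, sets of the form above are, for the Tukey
    order, finite subsets of omega_1 together with a natural number, and the
    number can be absorbed by a countable subset of [E]
    ([tukey_RK_finite_subsets]). *)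

(** * The Banach space of a family of sets *)

Section family_space.
Context {R : realType} {N : choiceType}.
Implicit Types (A : set (set N)) (phi : N -> R) (l : seq (R * N)).

(** The norming functionals: sequences bounded by one and supported in the family.
    Allowing all values in [-1, 1], not just signs, makes the set of functionals
    solid, and evaluating at all of them yields the sum of absolute values. *)
Definition norming A phi : Prop :=
  (forall n, `|phi n| <= 1) /\ A [set n | phi n != 0].

(** Vectors are represented by the values that the norming functionals take on
    them, so that the norm becomes a supremum norm.  Giving the value 0 outside the
    norming functionals spares a subtype. *)
Definition coordinate A (n : N) : (N -> R) -> R^o :=
  fun phi => if `[< norming A phi >] then phi n else 0.

Definition combination A l : (N -> R) -> R^o :=
  \sum_(p <- l) p.1 *: coordinate A p.2.

Definition in_closed_span A : {pred (N -> R) -> R^o} := fun y =>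
  `[< forall eps : R, 0 < eps ->
      exists l, forall phi, `|y phi - combination A l phi| <= eps >].

Lemma coordinate_le1 A n phi : `|coordinate A n phi| <= 1.
Proof.
rewrite /coordinate; case: asboolP => [[+ _]|_]; first exact.
by rewrite normr0.
Qed.

Lemma combinationE A l phi :
  combination A l phi = \sum_(p <- l) p.1 * coordinate A p.2 phi.
Proof. by rewrite /combination fct_sumE. Qed.

Lemma combination_bounded A l :
  exists M : R, forall phi, `|combination A l phi| <= M.
Proof.
exists (\sum_(p <- l) `|p.1|) => phi; rewrite combinationE.
apply: le_trans (ler_norm_sum _ _ _) _; apply: ler_sum => p _.
by rewrite normrM ler_piMr// coordinate_le1.
Qed.

Lemma combination_in_closed_span A l : combination A l \in in_closed_span A.
Proof. by apply/asboolP => e e0; exists l => phi; rewrite subrr normr0 ltW. Qed.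

Lemma in_closed_span_submod A : submod_closed (in_closed_span A).
Proof.
split.
  apply/asboolP => e e0; exists [::] => phi.
  by rewrite /combination big_nil subr0 normr0 ltW.
move=> a u v /asboolP Hu /asboolP Hv; apply/asboolP => e e0.
have a0 : 0 < `|a| + 1 by rewrite ltr_wpDl.
have [|lu Hlu] := Hu (e / 2 / (`|a| + 1)); first by rewrite !divr_gt0.
have [|lv Hlv] := Hv (e / 2); first by rewrite divr_gt0.
exists ([seq (a * p.1, p.2) | p <- lu] ++ lv) => phi.
rewrite combinationE big_cat big_map /= -combinationE.
have -> : \sum_(j <- lu) a * j.1 * coordinate A j.2 phi =
    a * combination A lu phi.
  by rewrite combinationE mulr_sumr; apply: eq_bigr => p _; rewrite mulrA.
have -> : (a *: u + v) phi - (a * combination A lu phi + combination A lv phi) =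
    a * (u phi - combination A lu phi) + (v phi - combination A lv phi).
  by rewrite mulrBr opprD addrACA.
apply: le_trans (ler_normD _ _) _; rewrite normrM [leRHS](splitr e).
apply: lerD => //.
apply: le_trans (_ : (`|a| + 1) * (e / 2 / (`|a| + 1)) <= _).
  by apply: ler_pM => //; rewrite lerDl.
by rewrite mulrC divfK// gt_eqF.
Qed.

HB.instance Definition _ A :=
  GRing.isSubmodClosed.Build R _ (in_closed_span A) (in_closed_span_submod A).

Record family_space A := FamilySpace {
  test_value :> (N -> R) -> R^o ;
  test_valueP : test_value \in in_closed_span A }.

HB.instance Definition _ A := [isSub for @test_value A].
HB.instance Definition _ A := [Choice of family_space A by <:].
HB.instance Definition _ A := [SubChoice_isSubLmodule of family_space A by <:].

Lemma test_value_bounded A (y : family_space A) :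
  exists M : R, forall phi, `|y phi| <= M.
Proof.
have /asboolP/(_ 1 ltr01)[l Hl] := test_valueP y.
have [M HM] := combination_bounded A l; exists (1 + M) => phi.
by rewrite -[y phi](subrK (combination A l phi))
  (le_trans (ler_normD _ _))// lerD.
Qed.

Definition family_norm A (y : family_space A) : R :=
  sup (range (fun phi => `|y phi|)).

Lemma le_family_norm A (y : family_space A) phi : `|y phi| <= family_norm y.
Proof.
apply: ub_le_sup; last by exists phi.
by have [M HM] := test_value_bounded y; exists M => _ [phi' _ <-].
Qed.

Lemma family_norm_le A (y : family_space A) (M : R) :
  (forall phi, `|y phi| <= M) -> family_norm y <= M.
Proof.
move=> HM; apply: ge_sup; first by exists `|y 0|, 0.
by move=> _ [phi _ <-].
Qed.

Lemma test_valueD A (y z : family_space A) phi : (y + z) phi = y phi + z phi.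
Proof. by []. Qed.

Lemma test_valueN A (y : family_space A) phi : (- y) phi = - y phi.
Proof. by []. Qed.

Lemma test_valueZ A (a : R) (y : family_space A) phi :
  (a *: y) phi = a * y phi.
Proof. by []. Qed.

Lemma family_normD A (y z : family_space A) :
  family_norm (y + z) <= family_norm y + family_norm z.
Proof.
apply: family_norm_le => phi.
by rewrite test_valueD (le_trans (ler_normD _ _))// lerD// le_family_norm.
Qed.

Lemma family_normZ A (a : R) (y : family_space A) :
  family_norm (a *: y) = `|a| * family_norm y.
Proof.
have le_normZ b z : family_norm (b *: z : family_space A) <= `|b| * family_norm z.
  apply: family_norm_le => phi.
  by rewrite test_valueZ normrM ler_wpM2l// le_family_norm.
have [->|a0] := eqVneq a 0.
  apply/eqP; rewrite eq_le le_normZ normr0 mul0r /=.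
  by rewrite (le_trans _ (le_family_norm _ 0)).
apply/eqP; rewrite eq_le le_normZ /=.
have := le_normZ a^-1 (a *: y).
rewrite scalerA mulVf// scale1r normfV => H.
by rewrite -ler_pdivlMl// normr_gt0.
Qed.

Lemma family_norm_eq0 A (y : family_space A) : family_norm y = 0 -> y = 0.
Proof.
move=> y0; apply: val_inj; apply: funext => phi; apply/eqP.
by rewrite -normr_le0 -y0 le_family_norm.
Qed.

HB.instance Definition _ A := Lmodule_isNormed.Build R (family_space A)
  (@family_normD A) (@family_normZ A) (@family_norm_eq0 A).

Lemma ler_test_value A (y : family_space A) phi : `|y phi| <= `|y|.
Proof. exact: le_family_norm. Qed.

Lemma ler_test_dist A (y z : family_space A) phi :
  `|(y phi : R) - (z phi : R)| <= `|y - z|.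
Proof. exact: le_trans (ler_test_value (y - z) phi). Qed.

Lemma normr_test_le A (y : family_space A) (M : R) :
  (forall phi, `|y phi| <= M) -> `|y| <= M.
Proof. exact: family_norm_le. Qed.

(** A Cauchy filter converges at every test sequence, uniformly; a uniform limit of
    elements of the closed span stays in it. *)
Lemma family_space_complete A (F : set_system (family_space A)) :
  ProperFilter F -> cauchy F -> cvg F.
Proof.
move=> FF /cauchyP Fc.
have Fphi phi : cvg ((fun y : family_space A => y phi) @ F).
  apply: R_complete; apply/cauchyP => _ /posnumP[e].
  have [x Hx] := Fc _ (gt0 e); exists (x phi).
  change (F [set z | ball (x phi : R) e%:num (z phi)]).
  apply: filterS Hx => z; rewrite -!ball_normE /=.
  by apply: le_lt_trans; exact: ler_test_dist.
pose y phi : R := lim ((fun y : family_space A => y phi) @ F).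
have yP (e : R) : 0 < e -> exists x : family_space A,
    F (ball x e) /\ forall phi, `|x phi - y phi| <= e.
  move=> e0; have [x Hx] := Fc _ e0; exists x; split => // phi.
  have /cvgrPdist_le cy : (fun y : family_space A => y phi) @ F --> y phi := Fphi phi.
  apply/ler_addgt0Pr => d d0.
  have [z [xz yz]] : exists z : family_space A, ball x e z /\ `|y phi - z phi| <= d.
    by apply: (@filter_ex _ F); apply: (filterI Hx); exact: (cy _ d0).
  rewrite (le_trans (ler_distD (z phi) _ _))// lerD//; last by rewrite distrC.
  move: xz; rewrite -ball_normE /= => /ltW; apply: le_trans.
  exact: ler_test_dist.
have ys : y \in in_closed_span A.
  apply/asboolP => e e0; have [|x [_ xy]] := yP (e / 2); first by rewrite divr_gt0.
  have /asboolP/(_ (e / 2))[|l xl] := test_valueP x; first by rewrite divr_gt0.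
  exists l => phi; rewrite (le_trans (ler_distD (x phi) _ _))// [leRHS](splitr e).
  by rewrite lerD// distrC.
apply/cvg_ex; exists (FamilySpace ys); apply/cvgrPdist_le => e e0.
have [|x [Fx xy]] := yP (e / 2); first by rewrite divr_gt0.
apply: filterS Fx => z; rewrite -ball_normE /= => xz.
apply: normr_test_le => phi.
rewrite test_valueD test_valueN (le_trans (ler_distD (x phi) _ _))//.
rewrite [leRHS](splitr e) lerD//; first by rewrite distrC.
by rewrite (le_trans _ (ltW xz))//; exact: ler_test_dist.
Qed.

HB.instance Definition _ A :=
  Uniform_isComplete.Build (family_space A) (@family_space_complete A).

End family_space.
Arguments family_space R {N} A.

(** * Weak topology *)

Lemma initial_cvg (S : choiceType) (T : topologicalType) (f : S -> T)
    (F : set_system S) (s : S) :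
  Filter F -> f @ F --> f s -> F --> (s : initial_topology f).
Proof.
move=> FF fF A /= [_ [[B Bop <-] Bfs sBfA]].
rewrite nbhs_filterE; apply: filterS sBfA _; apply: fF.
by rewrite nbhsE; exists B.
Qed.

Section weak_topology.
Context {R : realType} (X : completeNormedModType R).

Lemma weak_continuous (f : topological_dual X) :
  continuous (fun x : weak_space X => val f x : R^o).
Proof.
move=> x.
pose ev (x : X) : prod_topology (fun _ : topological_dual X => R^o) :=
  fun f => val f x.
have ev_cts : {for x, continuous (ev : weak_space X -> _)} by exact: initial_continuous.
apply: (@continuous_comp _ _ _ (ev : weak_space X -> _) (@proj _ (fun=> R^o) f)).
  exact: ev_cts.
exact: proj_continuous.
Qed.

Lemma weak_cvg (F : set_system X) (FF : Filter F) (x : X) :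
  (forall f : topological_dual X, (val f : X -> R^o) @ F --> (val f x : R^o)) ->
  F --> (x : weak_space X).
Proof.
move=> Fx; apply: initial_cvg; apply/cvg_sup => f; apply: initial_cvg.
exact: Fx f.
Qed.

Lemma weak_hausdorff :
  (forall x y : X, (forall f : topological_dual X, val f x = val f y) -> x = y) ->
  hausdorff_space (weak_space X).
Proof.
move=> sep x y xy; apply: sep => f.
apply: (@norm_hausdorff R R^o) => U V Ux Vy.
have [z [Uz Vz]] := xy _ _ (weak_continuous Ux) (weak_continuous Vy).
by exists (val f z).
Qed.

(** The set together with 0 is compact, because every weak neighbourhood of 0 misses
    only finitely many points: a filter on it either clusters at 0 or lives on a
    finite set.  The Hausdorff property makes this compact set closed. *)
Lemma weakly_null_relatively_compact (S : set X) :
  hausdorff_space (weak_space X) ->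
  (forall (f : topological_dual X) (eps : R), 0 < eps ->
    finite_set [set x | S x /\ eps <= `|val f x|]) ->
  relatively_weakly_compact S.
Proof.
move=> hX Sf.
pose G : set_system (weak_space X) := fun U => finite_set (S `\` U).
have FG : Filter G.
  split; first by rewrite /G /= setDT.
    by move=> P Q GP GQ; rewrite /G /= setDIr finite_setU.
  by move=> P Q PQ; apply: sub_finite_set; exact: setDS.
have G0 : G --> (0 : weak_space X).
  apply: weak_cvg => f; apply/cvgrPdist_lt => e e0.
  apply: sub_finite_set (Sf f e e0) => x /= [Sx] /negP.
  by rewrite linear0 sub0r normrN -leNgt.
pose K : set (weak_space X) := S `|` [set 0].
suff cK : compact K.
  apply: (@precompact_subset (weak_space X) S K); first by move=> x; left.
  exact: compact_precompact.
move=> F FF FK; apply: contrapT => ncl.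
have [U [V [FU V0 UV]]] : exists U V, [/\ F U, nbhs (0 : weak_space X) V &
    U `&` V = set0].
  apply: contrapT => nUV; apply: ncl; exists 0; split; first by right.
  move=> U V FU V0; apply: contrapT => UV; apply: nUV.
  by exists U, V; split => //; rewrite -subset0 => x UVx; apply: UV; exists x.
have FT : F (S `\` V).
  apply: filterS (filterI FK FU) => x [[Sx|->] Ux].
    by split=> // Vx; have : (U `&` V) x by []; rewrite UV.
  have : (U `&` V) 0 by split=> //; exact: (nbhs_singleton V0).
  by rewrite UV.
have cT : compact (S `\` V : set (weak_space X)).
  by apply: finite_compact; exact: (G0 _ V0).
have [x [[Sx _] Fx]] := cT F FF FT.
by apply: ncl; exists x; split => //; left.
Qed.

End weak_topology.

(** * The unit vectors as an unconditional basis *)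

Lemma sum_fset_sub (V : nmodType) (T : choiceType) (F G : {fset T})
    (h : T -> V) : {subset G <= F} ->
  \sum_(x <- F | x \in G) h x = \sum_(x <- G) h x.
Proof.
move=> GF; rewrite -big_filter; apply: perm_big.
apply: uniq_perm; rewrite ?filter_uniq ?fset_uniq// => x.
by rewrite mem_filter; case: (boolP (x \in G)) => // xG; rewrite (GF x xG).
Qed.

Section linear_span.
Context {R : realType} {X : completeNormedModType R}.
Implicit Types (B : set X) (u v x : X).

Lemma linear_span_vector B x : B x -> linear_span B x.
Proof.
move=> Bx; exists [fset x]%fset, (fun=> 1); split.
  by move=> y /=; rewrite inE => /eqP ->.
by rewrite big_seq_fset1 scale1r.
Qed.

Lemma linear_spanD B (a : R) u v :
  linear_span B u -> linear_span B v -> linear_span B (a *: u + v).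
Proof.
move=> [F [c [FB ->]]] [G [d [GB ->]]].
pose e x := (if x \in F then a * c x else 0) + (if x \in G then d x else 0).
exists (F `|` G)%fset, e; split.
  by move=> x /=; rewrite inE => /orP[/FB|/GB].
have eE x : e x *: x = (if x \in F then (a * c x) *: x else 0) +
    (if x \in G then d x *: x else 0).
  by rewrite /e scalerDl; congr (_ + _); case: ifP; rewrite ?scale0r.
rewrite (eq_bigr _ (fun x _ => eE x)) big_split /= -!big_mkcond /=.
rewrite !sum_fset_sub; last 2 first.
- by move=> x xG; rewrite inE xG orbT.
- by move=> x xF; rewrite inE xF.
by congr (_ + _); rewrite scaler_sumr; apply: eq_bigr => x _; rewrite scalerA.
Qed.

End linear_span.

Section coordinate_basis.
Context {R : realType} {N : choiceType} (A : set (set N)).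
Hypothesis hereditaryA : forall C D, D `<=` C -> A C -> A D.
Hypothesis singletonA : forall n, A [set n].
Notation X := (family_space R A).

Lemma coordinate_in_closed_span n : coordinate A n \in @in_closed_span R N A.
Proof.
suff <- : combination A [:: (1 : R, n)] = coordinate A n.
  exact: combination_in_closed_span.
by rewrite /combination big_cons big_nil addr0 scale1r.
Qed.

Definition basis_vector n : X := FamilySpace (coordinate_in_closed_span n).

Lemma basis_vectorE n (phi : N -> R) :
  norming A phi -> basis_vector n phi = phi n.
Proof. by move=> Aphi; rewrite /= /coordinate asboolT. Qed.

Lemma basis_vector_notin n (phi : N -> R) :
  ~ norming A phi -> basis_vector n phi = 0.
Proof. by move=> Aphi; rewrite /= /coordinate asboolF. Qed.

Lemma norming_restrict (phi : N -> R) (b : pred N) :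
  norming A phi -> norming A (fun n => if b n then phi n else 0).
Proof.
move=> [phi1 Aphi]; split=> [n|]; first by case: ifP; rewrite ?normr0.
by apply: hereditaryA Aphi => n /=; case: ifP => //; rewrite eqxx.
Qed.

Lemma norming_indic C : A C -> norming A (\1_C : N -> R).
Proof.
move=> AC; split=> [n|].
  by rewrite indicE; case: (n \in C); rewrite ?normr1 ?normr0.
apply: hereditaryA AC => n /=; rewrite indicE.
by case: (boolP (n \in C)) => [|_]; rewrite ?inE// eqxx.
Qed.

Lemma test_value_sum (I : Type) (s : seq I) (P : pred I) (u : I -> X) phi :
  (\sum_(i <- s | P i) u i) phi = \sum_(i <- s | P i) (u i phi : R).
Proof. by elim/big_rec2 : _ => // i y1 y2 _ <-. Qed.

Lemma normr_basis_vector n : `|basis_vector n| = 1.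
Proof.
apply/eqP; rewrite eq_le; apply/andP; split.
  by apply: normr_test_le => phi; exact: coordinate_le1.
have := ler_test_value (basis_vector n) (\1_[set n]).
rewrite basis_vectorE; last exact: norming_indic.
by rewrite indicE mem_set// normr1.
Qed.

Lemma basis_vector_inj : injective basis_vector.
Proof.
move=> n m nm; apply: contrapT => neq.
have := @basis_vectorE n (\1_[set n]) (norming_indic (singletonA n)).
rewrite nm basis_vectorE; last exact: norming_indic.
rewrite !indicE [in RHS]mem_set// memNset; last by move=> /= mn; apply: neq.
by move/eqP; rewrite eq_sym oner_eq0.
Qed.

Lemma closure_linear_span_basis : closure (linear_span (range basis_vector)) = setT.
Proof.
apply/seteqP; split => // y _ U /nbhs_ballP[e /= e0 yU].
have /asboolP/(_ (e / 2))[|l yl] := test_valueP y; first by rewrite divr_gt0.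
pose z : X := \sum_(p <- l) p.1 *: basis_vector p.2.
exists z; split.
  rewrite /z; elim: l {yl z} => [|p l IHl].
    rewrite big_nil; exists fset0, (fun=> 0); split => //.
    by rewrite big_seq_fset0.
  rewrite big_cons; apply: linear_spanD => //.
  by apply: linear_span_vector; exists p.2.
apply: yU; rewrite -ball_normE /=; apply: (@le_lt_trans _ _ (e / 2)); last first.
  by rewrite ltr_pdivrMr// ltr_pMr// ltr1n.
apply: normr_test_le => phi; have := yl phi.
suff -> : combination A l phi = z phi by [].
by rewrite combinationE test_value_sum; apply: eq_bigr.
Qed.

(** Restricting a norming functional to the indices of [G] gives again a norming
    functional, whose value on the larger sum is the value on the smaller one. *)
Lemma basis_unconditional (F G : {fset X}) (a : X -> R) :
  [set` G] `<=` [set` F] -> [set` F] `<=` range basis_vector ->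
  `|\sum_(x <- G) a x *: x| <= `|\sum_(x <- F) a x *: x|.
Proof.
move=> GF FB; apply: normr_test_le => phi.
rewrite test_value_sum.
have [Aphi|Aphi] := pselect (norming A phi); last first.
  rewrite big_seq big1 ?normr0// => x /GF/FB[n _ <-].
  by rewrite test_valueZ basis_vector_notin// mulr0.
pose psi n := if basis_vector n \in G then phi n else 0.
apply: le_trans (ler_test_value _ psi); rewrite test_value_sum.
have Apsi : norming A psi by exact: norming_restrict.
rewrite le_eqVlt; apply/orP; left; apply/eqP; congr (`| _ |).
rewrite -(@sum_fset_sub R _ F G) // big_mkcond.
apply: eq_big_seq => x /FB[n _ <-]; case: ifPn => nG.
  by rewrite !test_valueZ !basis_vectorE// /psi nG.
by rewrite test_valueZ basis_vectorE// /psi (negPf nG) mulr0.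
Qed.

Definition evaluation (phi : N -> R) (y : X) : R^o := y phi.

Lemma evaluation_is_linear phi : linear (evaluation phi).
Proof. by []. Qed.

HB.instance Definition _ phi :=
  GRing.isLinear.Build R X R^o *:%R (evaluation phi) (@evaluation_is_linear phi).

Lemma evaluation_continuous phi : continuous (evaluation phi).
Proof.
apply: bounded_linear_continuous; apply/bounded_funP => r; exists r => x.
by apply: le_trans; exact: ler_test_value.
Qed.

Definition evaluation_dual phi : topological_dual X :=
  exist _ (evaluation phi : {linear X -> R^o})
    (mem_set (@evaluation_continuous phi)).

Lemma family_weak_hausdorff : hausdorff_space (weak_space X).
Proof.
apply: weak_hausdorff => x y xy; apply: val_inj; apply: funext => phi.
exact: (xy (evaluation_dual phi)).
Qed.

(** Suppose that the unit vectors indexed by [C] cluster weakly at [y].  For every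
    finite [F], evaluation at the indicator of [C `\` F] is 1 on almost all of these
    vectors, hence at [y]; but it vanishes on the vectors supported by [F], and
    these approximate [y]. *)
Lemma not_relatively_weakly_compact (S C : set N) :
  relatively_weakly_compact (basis_vector @` S) ->
  infinite_set C -> C `<=` S -> ~ A C.
Proof.
move=> cS Ci CS AC.
pose G : set_system (weak_space X) := fun U =>
  finite_set (C `\` basis_vector @^-1` U).
have FG : ProperFilter G.
  split.
    by rewrite /G preimage_set0 setD0.
  split; first by rewrite /G preimage_setT setDT.
    by move=> P Q GP GQ; rewrite /G preimage_setI setDIr finite_setU.
  by move=> P Q PQ; apply: sub_finite_set; apply: setDS; exact: preimage_subset.
move: cS; rewrite /relatively_weakly_compact precompactE => cS.
have [|y [_ Gy]] := cS G FG.
  rewrite /G (_ : _ `\` _ = set0)// -subset0 => n [Cn]; apply.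
  by apply: subset_closure; exists n => //; exact: CS.
have /asboolP/(_ (4^-1)) [|l yl] := test_valueP (y : X); first by rewrite invr_gt0.
pose D := C `\` [set n | n \in [seq p.2 | p <- l]].
have AD : norming A (\1_D : N -> R).
  by apply: norming_indic; apply: hereditaryA AC; exact: subDsetl.
have l0 : combination A l (\1_D) = 0.
  rewrite combinationE big1_seq// => p /andP[_ pl].
  rewrite -[coordinate _ _ _]/(basis_vector p.2 _) basis_vectorE// indicE.
  rewrite memNset ?mulr0//.
  by move=> [_]; apply; apply/mapP; exists p.
have yD : `|(y : X) (\1_D)| <= 4^-1 by have := yl (\1_D); rewrite l0 subr0.
have [] := Gy (basis_vector @` D) [set z : X | `|(y : X) \1_D - z \1_D| < 4^-1 :> R].
- apply: sub_finite_set (finite_seq [seq p.2 | p <- l]) => n [Cn nD].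
  apply: contrapT => /= nl; apply: nD; exists n => //; split => //.
- have := @weak_continuous R X (evaluation_dual (\1_D)) y.
  move/cvgrPdist_lt => /(_ 4^-1); apply; by rewrite invr_gt0.
- move=> _ [[n Dn <-] /=]; rewrite -[coordinate _ _ _]/(basis_vector n _).
  rewrite basis_vectorE// indicE mem_set// => yn.
  have : 1 < 4^-1 + 4^-1 :> R.
    rewrite -[ltLHS]normr1 -[X in `|X|](subrK ((y : X) \1_D : R)).
    by rewrite (le_lt_trans (ler_normD _ _))// ltr_leD// distrC.
  lra.
Qed.

(** Multiplying the coefficients by the signs of the values of [f] leaves the norm
    unchanged, so a functional that is large in absolute value on some unit vectors
    prevents their convex combinations from having small norm. *)
Lemma dual_lower_bound (f : topological_dual X) :
  exists2 K : R, 0 < K & forall (s : seq N) (w : N -> R) (eps r : R), 0 <= r ->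
    (forall n, n \in s -> 0 <= w n /\ eps <= `|val f (basis_vector n)|) ->
    (forall C, A C -> \sum_(n <- s | n \in C) w n <= r) ->
    eps * (\sum_(n <- s) w n) <= K * r.
Proof.
have fc : continuous (val f) := set_valP f.
have [K K0 fK] : exists2 K : R, 0 < K & forall x, `|val f x| <= K * `|x|.
  by apply: pinfty_ex_gt0; apply/linear_boundedP/linear_bounded_continuous.
exists K => // s w eps r r0 ws wr.
pose y : X :=
  \sum_(n <- s) (w n * Num.sg (val f (basis_vector n) : R)) *: basis_vector n.
have fy : val f y = \sum_(n <- s) w n * `|val f (basis_vector n)| :> R.
  rewrite /y linear_sum; apply: eq_bigr => n _.
  by rewrite linearZ [in RHS]normrEsg [RHS]mulrA.
apply: (@le_trans _ _ (K * `|y|)).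
  apply: le_trans (fK y); apply: le_trans (ler_norm _).
  rewrite fy mulr_sumr big_seq [leRHS]big_seq; apply: ler_sum => n /ws[wn fn].
  by rewrite mulrC ler_wpM2l.
apply: ler_wpM2l; [exact: ltW|apply: normr_test_le => phi]; rewrite test_value_sum.
have [Aphi|Aphi] := pselect (norming A phi); last first.
  by rewrite big1 ?normr0// => n _; rewrite test_valueZ basis_vector_notin ?mulr0.
apply: le_trans (ler_norm_sum _ _ _) _; apply: le_trans (wr _ Aphi.2).
rewrite [leRHS]big_mkcond big_seq [leRHS]big_seq; apply: ler_sum => n /ws[wn _].
rewrite test_valueZ basis_vectorE//.
case: ifPn; rewrite ?(inE, notin_setE) /= => phin.
  rewrite !normrM (ger0_norm wn) -mulrA ler_piMr// mulr_ile1//; last exact: Aphi.1.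
  by rewrite normr_sg; case: (_ != 0).
by move/negP: phin; rewrite negbK => /eqP ->; rewrite mulr0 normr0.
Qed.

End coordinate_basis.

(** * Families with small convex combinations *)

Section null_families.
Context {R : realType}.
Implicit Types (u v w : nat -> R) (D : set nat) (S : set (nat -> R)).

Definition probability_vector w : Prop :=
  (forall k, 0 <= w k) /\
  exists2 m, (forall k, (m <= k)%N -> w k = 0) & \sum_(k < m) w k = 1.

Definition vanishes_below n w : Prop := forall k, (k < n)%N -> w k = 0.

(** The abstract properties of a set of convex combinations of a sequence that the
    averaging argument uses.  They are inherited by the subset of the vectors that
    are small on a null family ([convex_rich_small]), so that smallness on several
    families can be obtained successively. *)
Definition convex_rich S : Prop :=
  [/\ forall w, S w -> probability_vector w,
      forall u v (t : R), S u -> S v -> 0 <= t <= 1 ->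
        S (fun k => t * u k + (1 - t) * v k) &
      forall n, exists2 w, S w & vanishes_below n w].

Definition mass w D m : R := \sum_(k < m | (k : nat) \in D) w k.

Definition small_on w (Phi : set (set nat)) (delta : R) : Prop :=
  forall D m, Phi D -> mass w D m <= delta.

Definition null_family (Phi : set (set nat)) : Prop :=
  forall S (delta : R), convex_rich S -> 0 < delta ->
    exists2 w, S w & small_on w Phi delta.

Lemma massZD (t : R) u v D m :
  mass (fun k => t * u k + (1 - t) * v k) D m =
  t * mass u D m + (1 - t) * mass v D m.
Proof. by rewrite /mass big_split !mulr_sumr. Qed.

Lemma sum_after w m n : (forall k, (m <= k)%N -> w k = 0) -> (m <= n)%N ->
  \sum_(k < n) w k = \sum_(k < m) w k.
Proof.
move=> wm mn; rewrite -(big_mkord xpredT w) -(big_mkord xpredT w).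
rewrite (big_cat_nat (leq0n m) mn)//= [X in _ + X]big_nat [X in _ + X]big1 ?addr0//.
by move=> k /andP[mk _]; exact: wm.
Qed.

Lemma probability_vector_mass_le1 w D m : probability_vector w -> mass w D m <= 1.
Proof.
move=> [w0 [n wn w1]]; rewrite -w1 -(sum_after wn (leq_maxl n m)).
apply: (@le_trans _ _ (\sum_(k < m) w k)).
  by rewrite /mass [leRHS](bigID (fun k : 'I_m => (k : nat) \in D))/= lerDl sumr_ge0.
rewrite -(big_mkord xpredT w) -(big_mkord xpredT w).
by rewrite [leRHS](big_cat_nat (leq0n m) (leq_maxr n m))//= lerDl sumr_ge0.
Qed.

Lemma probability_vector_le1 w k : probability_vector w -> w k <= 1.
Proof.
move=> wP; have := probability_vector_mass_le1 [set k] k.+1 wP.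
rewrite /mass big_mkcond big_ord_recr /= mem_set// => h.
apply: le_trans h; rewrite lerDr sumr_ge0// => i _; case: ifP => // _.
by case: wP.
Qed.

Lemma mass_vanish w D m : (forall k, D k -> w k = 0) -> mass w D m = 0.
Proof. by move=> wD; apply: big1 => k; rewrite inE => /wD. Qed.

Lemma convex_rich_tail S n : convex_rich S ->
  convex_rich (S `&` vanishes_below n).
Proof.
move=> [SP Sc Sr]; split; first by move=> w [/SP].
  move=> u v t [Su un] [Sv vn] t01; split; first exact: Sc.
  by move=> k kn; rewrite un// vn// !mulr0 addr0.
move=> k; have [w Sw wk] := Sr (maxn n k); exists w.
  by split=> // i ik; apply: wk; rewrite leq_max ik.
by move=> i ik; apply: wk; rewrite leq_max ik orbT.
Qed.

Lemma convex_rich_small S Phi (delta : R) :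
  null_family Phi -> convex_rich S -> 0 < delta ->
  convex_rich (S `&` [set w | small_on w Phi delta]).
Proof.
move=> PhiN [SP Sc Sr] d0; split; first by move=> w [/SP].
  move=> u v t [Su ud] [Sv vd] /andP[t0 t1]; split; first by apply: Sc => //; rewrite t0.
  move=> D m PD; rewrite massZD.
  rewrite (_ : delta = t * delta + (1 - t) * delta); last by ring.
  by rewrite lerD// ler_wpM2l// ?subr_ge0//; [exact: ud|exact: vd].
move=> n; have [w [Sw wn] wd] := PhiN _ _ (convex_rich_tail n (And3 SP Sc Sr)) d0.
by exists w.
Qed.

Lemma convex_rich_small_finite S (Phi : nat -> set (set nat)) (delta : R) n :
  (forall i, null_family (Phi i)) -> convex_rich S -> 0 < delta ->
  convex_rich (S `&` [set w | forall i, (i < n)%N -> small_on w (Phi i) delta]).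
Proof.
move=> PhiN rS d0; elim: n => [|n IHn].
  by rewrite (_ : [set _ | _] = setT) ?setIT//; apply/seteqP; split.
have := convex_rich_small (PhiN n) IHn d0; congr convex_rich.
apply/seteqP; split => [w [[Sw wi] wn]|w [Sw wi]]; split => //.
- by move=> i; rewrite ltnS leq_eqVlt => /predU1P[->//|/wi].
- by split => // i /ltnW; exact: wi.
- exact: wi.
Qed.

Lemma null_family_bigcup (Phi : nat -> set (set nat)) n :
  (forall i, null_family (Phi i)) ->
  null_family (\bigcup_(i < n) Phi i).
Proof.
move=> PhiN S delta rS d0.
have [_ _ /(_ 0%N)[w [Sw wi] _]] := convex_rich_small_finite n PhiN rS d0.
by exists w => // D m [i /= ni PD]; exact: (wi i ni).
Qed.

(** Let [w] be the average of vectors [v_1, ..., v_L] with supports ordered from left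
    to right, each [v_j] being small on the families [Phi l] for all [l] up to the end
    of the supports of the earlier vectors.  A set [D'] in [Phi l] lies above [l], so
    it misses the vectors supported below [l]; all but one of the others are small on
    it, and the exceptional one contributes at most [1 / L].  The point [l] itself
    belongs to at most one support. *)
Lemma null_family_step (Phi : nat -> set (set nat)) (Psi : set (set nat)) :
  (forall l, null_family (Phi l)) ->
  (forall D, Psi D -> exists l D', [/\ Phi l D', D `<=` l |` D' &
     forall k, D' k -> (l < k)%N]) ->
  null_family Psi.
Proof.
move=> PhiN PsiD S delta rS d0.
have [SP Sc Sr] := rS.
(* The averages are built recursively: the new vector is supported beyond the
   bound [M] of the support of the old average, and small on [Phi l] for
   [l < M].  The inequalities are multiplied by the number of vectors. *)
have average L : exists2 w, S w & forall l D' m, Phi l D' ->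
    (forall k, D' k -> (l < k)%N) ->
    L.+1%:R * mass w D' m <= 1 + L.+1%:R * (delta / 2) /\
    L.+1%:R * w l <= 1.
  elim: L => [|L [w Sw wL]].
    have [w Sw _] := Sr 0%N; exists w => // l D' m _ _; rewrite !mul1r; split.
      apply: le_trans (probability_vector_mass_le1 _ _ (SP _ Sw)) _.
      by rewrite lerDl divr_ge0// ltW.
    exact: probability_vector_le1 (SP _ Sw).
  have [w0 [M wM _]] := SP _ Sw.
  have d20 : 0 < delta / 2 by rewrite divr_gt0.
  have [_ _ /(_ M)[v [Sv vPhi] vM]] := convex_rich_small_finite M PhiN rS d20.
  have [t [tE t'E t01]] : exists t : R,
      [/\ L.+2%:R * t = L.+1%:R, L.+2%:R * (1 - t) = 1 & 0 <= t <= 1].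
    have tE : L.+2%:R * (L.+1%:R / L.+2%:R) = L.+1%:R :> R.
      by rewrite mulrC divfK// pnatr_eq0.
    exists (L.+1%:R / L.+2%:R); split => //.
      by rewrite mulrBr mulr1 tE -natrB// subSnn.
    by rewrite divr_ge0//= ler_pdivrMr// mul1r ler_nat.
  exists (fun k => t * w k + (1 - t) * v k); first exact: Sc.
  move=> l D' m PD' lD'; have [wD' wl] := wL l D' m PD' lD'.
  have avgE a b : L.+2%:R * (t * a + (1 - t) * b) = L.+1%:R * a + b.
    by rewrite mulrDr !mulrA tE t'E mul1r.
  rewrite massZD !avgE.
  have LE : L.+2%:R = L.+1%:R + 1 :> R by rewrite natr1.
  have [lM|Ml] := ltnP l M; split.
  - by have := vPhi l lM D' m PD'; rewrite LE; move: wD'; lra.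
  - by rewrite vM// addr0.
  - rewrite mass_vanish; last first.
      by move=> k /lD' lk; apply: wM; rewrite ltnW// (leq_ltn_trans Ml).
    rewrite mulr0 add0r; apply: le_trans (probability_vector_mass_le1 _ _ (SP _ Sv)) _.
    by rewrite lerDl mulr_ge0 ?ler0n ?(ltW d20).
  - by rewrite wM// mulr0 add0r; apply: probability_vector_le1 (SP _ Sv).
(* With [L.+1] vectors, the mass of [D] is at most [2 / L.+1 + delta / 2]. *)
have [L Ld] : exists L : nat, 4 / delta < L.+1%:R.
  exists (Num.truncn (4 / delta)); exact: truncnS_gt.
have [w Sw wL] := average L; exists w => // D m PD.
have [l [D' [PD' DD' lD']]] := PsiD D PD.
have [wD' wl] := wL l D' m PD' lD'.
have [w0 _] := SP _ Sw.
have : mass w D m <= w l + mass w D' m.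
  rewrite /mass [leLHS]big_mkcond /=.
  apply: (@le_trans _ _ (\sum_(k < m | (k : nat) == l) w k + mass w D' m)).
    rewrite /mass [X in _ <= X + _]big_mkcond [X in _ <= _ + X]big_mkcond -big_split /=.
    apply: ler_sum => k _; have [kD|kD] := boolP (_ \in D); last first.
      by rewrite addr_ge0//; case: ifP.
    have [->|kl] := eqVneq (k : nat) l.
      by rewrite lerDl; case: ifP.
    rewrite add0r ifT//; move: kD; rewrite !inE => /DD'[/= kl'|//].
    by rewrite kl' eqxx in kl.
  rewrite lerD2r big_ord1_eq; case: ifP => // _; exact: w0.
have L0 : 0 < L.+1%:R :> R by [].
move=> mD; rewrite -(ler_pM2l L0); apply: le_trans (ler_wpM2l (ltW L0) mD) _.
move: Ld; rewrite ltr_pdivrMr//; nra.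
Qed.

End null_families.

(** * Branches outside a continuous image *)

Definition agree_below {T : Type} (n : nat) (s t : nat -> T) : Prop :=
  forall i, (i < n)%N -> s i = t i.

Definition strictly_increasing (c : nat -> nat) : Prop :=
  forall k, (c k < c k.+1)%N.

Lemma strictly_increasing_lt c j k :
  strictly_increasing c -> (j < k)%N -> (c j < c k)%N.
Proof.
move=> cI; elim: k => // k IHk; rewrite ltnS leq_eqVlt => /predU1P[->//|/IHk jk].
exact: ltn_trans jk (cI k).
Qed.

Lemma baire_cylinder (t : baire_space) (U : set baire_space) :
  nbhs t U -> exists n, forall s : nat -> nat, agree_below n s t -> U s.
Proof.
pose G : set_system baire_space :=
  fun U => exists n, forall s : nat -> nat, agree_below n s t -> U s.
have FG : Filter G.
  split; first by exists 0%N.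
    move=> P Q [n Pn] [m Qm]; exists (maxn n m) => s st; split.
      by apply: Pn => i im; apply: st; rewrite leq_max im.
    by apply: Qm => i im; apply: st; rewrite leq_max im orbT.
  by move=> P Q PQ [n Pn]; exists n => s /Pn/PQ.
suff Gt : G --> t by exact: Gt.
apply/cvg_sup => i; apply: initial_cvg => V Vt.
exists i.+1 => s /(_ i (ltnSn i)) /= si.
by rewrite /preimage /= si; exact: nbhs_singleton Vt.
Qed.

Lemma nbhs_cantor_coordinate (x : cantor_space) i :
  nbhs x [set y : cantor_space | y i = x i].
Proof.
apply: (@proj_continuous nat (fun=> bool) i x [set b | b = x i]).
exact: (fun b (bx : b = x i) => bx).
Qed.

Lemma cantor_eq_prefix (x y : cantor_space) :
  (forall n, agree_below n x y) -> x = y.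
Proof. by move=> xy; apply: funext => i; exact: (xy i.+1 i (ltnSn i)). Qed.

(** Allowing a closed domain treats the empty set and the nonempty analytic sets
    uniformly. *)
Lemma analytic_closed_image (E : set cantor_space) : analytic_set E ->
  exists (Z : set baire_space) (f : baire_space -> cantor_space),
    [/\ closed Z, continuous f & f @` Z = E].
Proof.
case=> [->|[f fc fE]]; last by exists setT, f; split => //; exact: closedT.
exists set0, (fun=> point); split; [exact: closed0|exact: cst_continuous|].
exact: image_set0.
Qed.

Section coded_branch.
Context {R : realType} (Z : set baire_space) (f : baire_space -> cantor_space).
Hypotheses (closedZ : closed Z) (fc : continuous f).

(** The levels at which members of coded sets lie on the branch [x], when the [n]
    smallest members are removed and the first [n] coordinates of the coding point
    are prescribed. *)
Definition trace_family (x : cantor_space) (n : nat) (t0 : nat -> nat) :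
    set (set nat) :=
  [set D | exists (t : baire_space) (c : nat -> nat),
    [/\ Z t, agree_below n t t0, strictly_increasing c,
        forall k, (t (n + k) <= c k)%N &
        forall l, D l -> (exists k, l = c k) /\ agree_below l (f t) x]].

Let upd (t : nat -> nat) n i : nat -> nat := fun k => if k == n then i else t k.

(** The smallest level [c 0] bounds the coordinate [t n], so the sets enumerated from
    level [l] on belong, apart from [l], to the union of the [l.+1] families in which
    the coordinate [n] is prescribed as well. *)
Lemma trace_family_step x n t0 :
  (forall i, null_family (R := R) (trace_family x n.+1 (upd t0 n i))) ->
  null_family (R := R) (trace_family x n t0).
Proof.
move=> tN; apply: (@null_family_step R
  (fun l => \bigcup_(i < l.+1) trace_family x n.+1 (upd t0 n i))).
  by move=> l; exact: null_family_bigcup.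
move=> D [t [c [Zt tt0 cI tc Dc]]].
exists (c 0%N), (D `&` [set k | (c 0%N < k)%N]); split => //.
- exists (t n); first by have := tc 0%N; rewrite addn0 /= ltnS.
  exists t, (c \o S); split => //.
  + move=> i; rewrite ltnS leq_eqVlt /upd => /predU1P[->|]; first by rewrite eqxx.
    by move=> i_n; rewrite ltn_eqF//; exact: tt0.
  + by move=> k; exact: cI.
  + by move=> k /=; rewrite addSnnS.
  + move=> l [/Dc[[[|k] lc] fl] /= cl]; last by split => //; exists k.
    by move: cl; rewrite lc ltnn.
- move=> l Dl; have [[[|k] lc] _] := Dc l Dl; first by left.
  by right; split => //=; rewrite lc; exact: strictly_increasing_lt.
- by move=> k [].
Qed.

(** Otherwise [trace_family_step] provides coordinates one after the other such that
    no initial part of the limit [t] gives a null family.  A family that is not null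
    contains sets with arbitrarily high levels, which are coded by points [s] of [Z]
    that agree with [t] on its initial part and for which [f s] agrees with [x] for
    long.  As [Z] is closed and [f] is continuous, [t] is in [Z] and [f t = x]. *)
Lemma trace_family_null x : ~ (f @` Z) x -> forall t0,
  null_family (R := R) (trace_family x 0 t0).
Proof.
move=> fx t0; apply: contrapT => N0.
have /choice[g gP] : forall p : nat * (nat -> nat), exists i,
    ~ null_family (R := R) (trace_family x p.1 p.2) ->
    ~ null_family (R := R) (trace_family x p.1.+1 (upd p.2 p.1 i)).
  move=> [n t] /=; apply: contrapT => nN; apply: (nN); exists 0%N => tN _.
  apply: tN; apply: trace_family_step => i; apply: contrapT => iN.
  by apply: nN; exists i.
pose T := fix T n := if n is m.+1 then upd (T m) m (g (m, T m)) else t0.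
have TN n : ~ null_family (R := R) (trace_family x n (T n)).
  by elim: n => // n IHn; exact: (gP (n, T n)).
pose t : baire_space := fun n => T n.+1 n.
have Tt n : agree_below n (T n) t.
  elim: n => // n IHn i; rewrite ltnS leq_eqVlt => /predU1P[->//|i_n].
  by rewrite /= /upd ltn_eqF//; exact: IHn.
have approx n m : exists s : baire_space,
    [/\ Z s, agree_below n s t & agree_below m (f s) x].
  apply: contrapT => ns; apply: (TN n) => S delta [SP Sc Sr] d0.
  have [w Sw wm] := Sr m; exists w => // D k [s [c [Zs sT cI sc Dc]]].
  rewrite mass_vanish ?ltW// => l Dl; apply: wm.
  rewrite ltnNge; apply/negP => ml; apply: ns; exists s; split => //.
    by move=> i i_n; rewrite sT// Tt.
  have [_ fl] := Dc l Dl.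
  by move=> i im; apply: fl; exact: leq_trans im ml.
apply: fx; exists t.
  apply: closedZ => U /baire_cylinder[n nU].
  by have [s [Zs st _]] := approx n 0%N; exists s; split => //; exact: nU.
apply: cantor_eq_prefix => m i im.
have := fc (nbhs_cantor_coordinate (f t) i) => /baire_cylinder[n nU].
have [s [Zs st sx]] := approx n m.
by rewrite -(sx i im); apply/esym; exact: (nU s st).
Qed.

End coded_branch.

(** * Sets of nodes of the binary tree *)

Definition branch (x : nat -> bool) : set (seq bool) :=
  [set s | s = mkseq x (size s)].

Definition antichain (D : set (seq bool)) : Prop :=
  forall s t, D s -> D t -> prefix s t -> s = t.

(** The requirement [t k <= c k] is what allows a recovery of [t] from the set up to
    finitely many choices at each step; it is an inequality so that every infinite
    part of a branch contains the range of an admissible [c]. *)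
Definition coded (Z : set baire_space) (f : baire_space -> cantor_space)
    (D : set (seq bool)) : Prop :=
  exists (t : baire_space) (c : nat -> nat),
    [/\ Z t, strictly_increasing c, forall k, (t k <= c k)%N &
        D `<=` range (fun k => mkseq (f t) (c k))].

Definition branch_covered (E : set cantor_space) (S : set (seq bool)) : Prop :=
  exists (F : seq cantor_space) (m : nat), (forall x, x \in F -> E x) /\
    forall s, S s -> (size s < m)%N \/ exists2 x, x \in F & branch x s.

Lemma mkseq_inj (x : nat -> bool) : injective (mkseq x).
Proof. by move=> m n /(congr1 size); rewrite !size_mkseq. Qed.

Lemma take_mkseq (x : nat -> bool) j n :
  (j <= n)%N -> take j (mkseq x n) = mkseq x j.
Proof. by move=> jn; rewrite /mkseq -map_take take_iota (minn_idPl jn). Qed.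

Lemma finite_short_seq m : finite_set [set s : seq bool | (size s < m)%N].
Proof.
elim: m => [|m IHm].
  by rewrite (_ : [set _ | _] = set0)//; apply/seteqP; split.
apply: (@sub_finite_set _ _ ([set [::]] `|`
    (cons true @` [set s | (size s < m)%N] `|`
     cons false @` [set s | (size s < m)%N]))).
  move=> [|[] s] /=; rewrite ?ltnS => sm; first by left.
    by right; left; exists s.
  by right; right; exists s.
by rewrite !finite_setU; split; [exact: finite_set1|split; exact: finite_image].
Qed.

Lemma infinite_seq_long (S : set (seq bool)) n :
  infinite_set S -> exists2 s, S s & (n <= size s)%N.
Proof.
move=> Si; apply: contrapT => nS; apply: Si.
apply: sub_finite_set (finite_short_seq n) => s Ss /=.
by rewrite ltnNge; apply/negP => ns; apply: nS; exists s.
Qed.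

Lemma infinite_range (T : choiceType) (h : nat -> T) :
  injective h -> infinite_set (range h).
Proof.
move=> hI; rewrite (eq_finite_set (inj_card_eq (in2W hI))).
exact: infinite_nat.
Qed.

Lemma branch_infinite_coded Z f t (S : set (seq bool)) : Z t ->
  infinite_set S -> S `<=` branch (f t) ->
  exists D, [/\ infinite_set D, D `<=` S & coded Z f D].
Proof.
move=> Zt Si Sb.
have long n : exists k, (n <= k)%N /\ S (mkseq (f t) k).
  have [s Ss ns] := infinite_seq_long n Si.
  by exists (size s); split => //; rewrite -(Sb s Ss).
have [g gP] := choice long.
pose c := fix c k := if k is j.+1 then g (maxn (c j).+1 (t k)) else g (t 0%N).
have cS k : S (mkseq (f t) (c k)) by case: k => [|k]; apply: (gP _).2.
have cI : strictly_increasing c.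
  by move=> k; apply: leq_trans (gP _).1; rewrite leq_max leqnn.
exists (range (fun k => mkseq (f t) (c k))); split.
- apply: infinite_range => j k /mkseq_inj.
  have [jk|kj|//] := ltngtP j k => cjk.
    by have := strictly_increasing_lt cI jk; rewrite cjk ltnn.
  by have := strictly_increasing_lt cI kj; rewrite cjk ltnn.
- by move=> _ [k _ <-].
- exists t, c; split => // -[|k] /=; first exact: (gP _).1.
  by apply: leq_trans (gP _).1; rewrite leq_max leqnn orbT.
Qed.

(** If [S] is not almost covered, follow a branch [x] all of whose nodes have above
    them a part of [S] that is not almost covered.  That part is not contained in
    [b_x].  Choosing members of [S] off [b_x] that leave [b_x] later and later gives
    an infinite antichain. *)
Lemma antichain_free_covered (S : set (seq bool)) :
  (forall D, infinite_set D -> D `<=` S -> ~ antichain D) ->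
  branch_covered setT S.
Proof.
move=> Sn; apply: contrapT => bad.
pose below s := S `&` [set u | prefix s u].
have split_bad s : exists b, ~ branch_covered setT (below s) ->
    ~ branch_covered setT (below (rcons s b)).
  apply: contrapT => nb; apply: (nb); exists true => bs [Ft [mt [_ Ct]]].
  apply: nb; exists false => _ [Ff [mf [_ Cf]]]; apply: bs.
  exists (Ft ++ Ff), (maxn (size s).+1 (maxn mt mf)); split => // u [Su /prefixP[v uE]].
  case: v uE => [|[] v] uE.
  - by left; rewrite uE cats0 leq_max leqnn.
  - have [|um|[x xF xu]] := Ct u.
    + by split => //=; rewrite uE -cat_rcons prefix_prefix.
    + by left; rewrite !leq_max um !orbT.
    + by right; exists x => //; rewrite mem_cat xF.
  - have [|um|[x xF xu]] := Cf u.
    + by split => //=; rewrite uE -cat_rcons prefix_prefix.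
    + by left; rewrite !leq_max um !orbT.
    + by right; exists x => //; rewrite mem_cat xF orbT.
have [g gP] := choice split_bad.
pose node := fix node n := if n is m.+1 then rcons (node m) (g (node m)) else [::].
pose x n := g (node n).
have nodeE n : node n = mkseq x n.
  by elim: n => // n IHn; rewrite mkseqS -IHn.
have node_bad n : ~ branch_covered setT (below (node n)).
  elim: n => [|n IHn]; last exact: gP.
  rewrite (_ : below _ = S)//; apply/seteqP; split => [u []|u Su]//.
  by split => //=; rewrite prefix0s.
have escape n : exists u, [/\ S u, prefix (mkseq x n) u & ~ branch x u].
  apply: contrapT => nu; apply: (node_bad n); exists [:: (x : cantor_space)], 0%N.
  split => // u [Su nu']; right; exists x; first by rewrite inE.
  by apply: contrapT => xu; apply: nu; exists u; split => //; rewrite -nodeE.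
have [v vP] := choice escape.
pose h := fix h k := if k is j.+1 then (size (v (h j))).+1 else 0%N.
have vS n : (n <= size (v n))%N.
  by have [_ /size_prefix + _] := vP n; rewrite size_mkseq.
have hI : strictly_increasing h by move=> k /=; rewrite ltnS.
have hv j k : (j < k)%N -> (size (v (h j)) < h k)%N.
  move=> jk; have : (h j.+1 <= h k)%N.
    move: jk; rewrite leq_eqVlt => /predU1P[->//|jk].
    exact/ltnW/strictly_increasing_lt.
  exact: leq_trans.
have nprefix j k : j != k -> ~~ prefix (v (h j)) (v (h k)).
  have [jk|kj|//] := ltngtP j k => _; apply/negP => jkP.
    have [_ kP _] := vP (h k); have [_ _ jb] := vP (h j); apply: jb.
    move: jkP kP; rewrite !prefixE size_mkseq => /eqP jE /eqP kE.
    rewrite /branch /= -[LHS]jE -(take_takel _ (ltnW (hv _ _ jk))) kE.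
    by rewrite take_mkseq// ltnW// hv.
  have := size_prefix jkP; rewrite leqNgt => /negP; apply.
  exact: leq_trans (hv _ _ kj) (vS _).
apply: (Sn (range (v \o h))).
- apply: infinite_range => j k /= jk; apply/eqP; apply: contrapT => /negP /nprefix.
  by rewrite jk prefix_refl.
- by move=> _ [k _ <-] /=; have [] := vP (h k).
- move=> _ _ [j _ <-] [k _ <-] /= jk.
  by have [->//|/nprefix] := eqVneq j k; rewrite jk.
Qed.

(** In an almost cover by finitely many branches, a branch outside [E] can meet [S]
    only in a finite set, so that it can be dropped. *)
Lemma branch_covered_of_free (E : set cantor_space) Z f (S : set (seq bool)) :
  f @` Z = ~` E ->
  (forall D, infinite_set D -> D `<=` S -> ~ antichain D /\ ~ coded Z f D) ->
  branch_covered E S.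
Proof.
move=> fE Sn.
have [|F [m [_ Sm]]] := @antichain_free_covered S.
  by move=> D Di DS; have [] := Sn D Di DS.
have short (G : seq cantor_space) : exists k, forall x s, x \in G -> ~ E x ->
    S s -> branch x s -> (size s < k)%N.
  elim: G => [|y G [k kP]]; first by exists 0%N.
  have [Ey|Ey] := pselect (E y).
    exists k => x s; rewrite inE => /predU1P[->//|]; exact: kP.
  have [j jP] : exists j, forall s, S s -> branch y s -> (size s < j)%N.
    apply: contrapT => nj.
    have yi : infinite_set (S `&` branch y).
      move=> /finite_seqP[l lE]; apply: nj; exists (\max_(s <- l) size s).+1 => s Ss ys.
      rewrite ltnS; apply: (@leq_bigmax_seq _ _ xpredT size) => //.
      by have : [set` l] s by rewrite -lE.
    have [t Zt fty] : (f @` Z) y by rewrite fE.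
    have [|D [Di DS cD]] := @branch_infinite_coded Z f t _ Zt yi.
      by rewrite fty; move=> s [].
    by have [_ /(_ cD)] := Sn D Di (subset_trans DS (@subIsetl _ _ _)).
  exists (maxn j k) => x s; rewrite inE => /predU1P[-> _ Ss ys|xG Ex Ss xs].
    by rewrite leq_max jP.
  by rewrite leq_max (kP x s xG Ex Ss xs) orbT.
have [k kP] := short F.
exists [seq x <- F | `[< E x >]], (maxn m k); split.
  by move=> x; rewrite mem_filter => /andP[/asboolP].
move=> s Ss; have [sm|[x xF xs]] := Sm s Ss; first by left; rewrite leq_max sm.
have [Ex|Ex] := pselect (E x).
  by right; exists x => //; rewrite mem_filter xF andbT; apply/asboolP.
by left; rewrite leq_max (kP x s xF Ex Ss xs) orbT.
Qed.

(** * Relatively weakly compact sets of the tree basis *)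

Definition tree_family (Z : set baire_space) (f : baire_space -> cantor_space) :
    set (set (seq bool)) := [set D | antichain D \/ coded Z f D].

Lemma tree_family_hereditary Z f C D :
  D `<=` C -> tree_family Z f C -> tree_family Z f D.
Proof.
move=> DC [aC|[t [c [Zt cI tc Cc]]]].
  by left=> s u /DC Cs /DC Cu; exact: aC.
by right; exists t, c; split => //; exact: subset_trans Cc.
Qed.

Lemma tree_family_singleton Z f s : tree_family Z f [set s].
Proof. by left=> _ _ -> ->. Qed.

Section tree_basis.
Context {R : realType} (Z : set baire_space) (f : baire_space -> cantor_space).
Hypotheses (closedZ : closed Z) (fc : continuous f).
Notation X := (family_space R (tree_family Z f)).
Notation e := (@basis_vector R _ (tree_family Z f)).

Definition subsingletons : set (set nat) :=
  [set D | forall i j, D i -> D j -> i = j].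

Lemma subsingletons_null : null_family (R := R) subsingletons.
Proof.
apply: (@null_family_step R (fun=> [set set0])).
  move=> _ S delta [_ _ Sr] d0; have [w Sw _] := Sr 0%N; exists w => // D m ->.
  by rewrite mass_vanish ?ltW.
move=> D D1; have [[i Di]|D0] := pselect (exists i, D i).
  by exists i, set0; split => // j Dj; left; exact: D1.
by exists 0%N, set0; split => // j Dj; case: D0; exists j.
Qed.

Lemma probability_vectors_on_rich (M : set nat) : infinite_set M ->
  convex_rich [set w : nat -> R | probability_vector w /\
    forall k, ~ M k -> w k = 0].
Proof.
move=> Mi; split; first by move=> w [].
  move=> u v t [[u0 [mu um u1]] uM] [[v0 [mv vm v1]] vM] /andP[t0 t1]; split.
    split; first by move=> k; rewrite addr_ge0// mulr_ge0// subr_ge0.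
    exists (maxn mu mv).
      by move=> k; rewrite geq_max => /andP[/um -> /vm ->]; rewrite !mulr0 addr0.
    rewrite big_split -!mulr_sumr /= (sum_after um (leq_maxl _ _)).
    by rewrite (sum_after vm (leq_maxr _ _)) u1 v1 !mulr1 addrC subrK.
  by move=> k Mk; rewrite uM// vM// !mulr0 addr0.
move=> n; have [k Mk nk] : exists2 k, M k & (n <= k)%N.
  apply: contrapT => nM; apply: Mi; apply: sub_finite_set (finite_II n) => k Mk /=.
  by rewrite ltnNge; apply/negP => nk; apply: nM; exists k.
exists (fun i => (i == k)%:R); first split.
- split => [i|]; first by [].
  exists k.+1 => [i ki|]; first by rewrite gtn_eqF.
  rewrite big_ord_recr /= eqxx big1 ?add0r// => i _.
  by rewrite ltn_eqF.
- by move=> i Mi'; case: eqP => // ik; case: Mi'; rewrite ik.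
- by move=> i i_n; rewrite ltn_eqF// (leq_trans i_n).
Qed.

(** The members of the family that meet [b_x] either are antichains, and meet it in
    at most one node, or have their trace in [trace_family x 0].  Both kinds of traces
    form null families, so every infinite part of [b_x] has convex combinations of
    small norm, which contradicts [dual_lower_bound]. *)
Lemma branch_weakly_null (g : topological_dual X) (eps : R) (x : cantor_space) :
  ~ (f @` Z) x -> 0 < eps ->
  finite_set [set n | eps <= `|val g (e (mkseq x n))|].
Proof.
move=> fx e0; apply: contrapT => Mi.
set M := [set n | _] in Mi.
have [K K0 gK] := dual_lower_bound g.
pose delta := eps / (2 * K).
have d0 : 0 < delta by rewrite divr_gt0// mulr_gt0.
have rS := probability_vectors_on_rich Mi.
have [w [[wP wM] wt] ws] := subsingletons_null
  (convex_rich_small (trace_family_null closedZ fc fx (fun=> 0%N)) rS d0) d0.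
have [w0 [m wm w1]] := wP.
pose s := [seq mkseq x k | k <- iota 0 m & k \in M].
have sumE (P : pred (seq bool)) : \sum_(u <- s | P u) w (size u) =
    \sum_(k < m | ((k : nat) \in M) && P (mkseq x k)) w k.
  rewrite big_map big_filter_cond -[in iota 0 m](subn0 m) -/(index_iota 0 m) big_mkord.
  by apply: eq_bigr => k _; rewrite size_mkseq.
have := gK s (fun u => w (size u)) eps delta (ltW d0).
rewrite (sumE xpredT) (_ : \sum_(k < m | _) w k = 1); last first.
  rewrite -w1 big_mkcond; apply: eq_bigr => k _; rewrite andbT.
  by case: ifPn => //; rewrite notin_setE => /wM.
have -> : K * delta = eps / 2 by rewrite /delta; field; rewrite gt_eqF.
rewrite mulr1 leNgt ltr_pdivrMr// ltr_pMr// ltr1n => /(_ _ _)/negP; apply => //.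
  move=> _ /mapP[k + ->]; rewrite mem_filter => /andP[/set_mem Mk _].
  by rewrite w0.
move=> C treeC; rewrite sumE.
pose D := [set k | M k /\ C (mkseq x k)].
rewrite (eq_bigl (fun k : 'I_m => (k : nat) \in D)); last first.
  by move=> k; apply/andP/idP; rewrite !inE.
case: treeC => [aC|[t [c [Zt cI tc Cc]]]].
  apply: ws => i j [_ Ci] [_ Cj]; apply: (@mkseq_inj x).
  have [ij|/ltnW ji] := leqP i j.
    by apply: aC => //; rewrite prefixE size_mkseq take_mkseq.
  by apply/esym; apply: aC => //; rewrite prefixE size_mkseq take_mkseq.
apply: wt; exists t, c; split => // l [_ /Cc[k _ kl]].
have lk : l = c k by rewrite -(size_mkseq x l) -kl size_mkseq.
split; first by exists k.
move=> i il; move: kl; rewrite lk => /(congr1 (fun u => nth false u i)).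
by rewrite !nth_mkseq -?lk.
Qed.

Lemma RK_tree_basis (E : set cantor_space) (S : set (seq bool)) :
  f @` Z = ~` E ->
  RK (range e) (e @` S) <-> branch_covered E S.
Proof.
move=> fE; split.
  move=> [_ cS]; apply: (branch_covered_of_free fE) => D Di DS.
  have := not_relatively_weakly_compact (@tree_family_hereditary Z f) cS Di DS.
  by move=> nD; split => aD; apply: nD; [left|right].
move=> [F [m [FE Sm]]]; split; first by move=> _ [s _ <-]; exists s.
apply: weakly_null_relatively_compact; first exact: family_weak_hausdorff.
move=> g eps e0.
apply: (@sub_finite_set _ _ (e @` ([set s | (size s < m)%N] `|`
  \bigcup_(x in [set` F]) (mkseq x @` [set n | eps <= `|val g (e (mkseq x n))|])))).
  move=> _ [[s Ss <-] gs]; exists s => //.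
  have [sm|[x xF xs]] := Sm s Ss; [by left|right].
  have xsE : mkseq x (size s) = s by exact: esym xs.
  by exists x => //; exists (size s); rewrite /= xsE.
apply: finite_image; rewrite finite_setU; split; first exact: finite_short_seq.
apply: bigcup_finite => // x /= xF; apply: finite_image.
by apply: branch_weakly_null => //; rewrite fE => nEx; apply: nEx; exact: FE.
Qed.

End tree_basis.

(** * Tukey equivalence *)

Lemma branch_mkseq x n : branch x (mkseq x n).
Proof. by rewrite /branch /= size_mkseq. Qed.

Lemma branch_separate (F : seq cantor_space) (x : cantor_space) : x \notin F ->
  exists N, forall y n, y \in F -> (N <= n)%N -> ~ branch y (mkseq x n).
Proof.
elim: F => [|y F IHF]; first by exists 0%N.
rewrite inE negb_or => /andP[xy /IHF[N NP]].
have [i xyi] : exists i, x i <> y i.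
  apply: contrapT => nxy; move/eqP: xy; apply; apply: funext => i.
  by apply: contrapT => xyi; apply: nxy; exists i.
exists (maxn N i.+1) => z n; rewrite inE geq_max => /predU1P[->|zF] /andP[Nn i_n].
  rewrite /branch /= size_mkseq => /(congr1 (fun u => nth false u i)).
  by rewrite !nth_mkseq.
exact: NP.
Qed.

Lemma finite_set_nat_bounded (A : set nat) : finite_set A ->
  exists m, forall i, A i -> (i < m)%N.
Proof.
move=> /finite_seqP[l ->]; exists (\max_(i <- l) i).+1 => i /= il.
by rewrite ltnS; apply: (@leq_bigmax_seq _ _ xpredT id).
Qed.

Lemma infinite_set_injection (T : pointedType) (A : set T) : infinite_set A ->
  exists2 h : nat -> T, injective h & forall i, A (h i).
Proof.
move=> /infiniteP/pcard_leP/injfunPex[h hA hI]; exists h => [i j|i].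
  by apply: hI; rewrite inE.
exact: hA.
Qed.

Section tukey.
Context {R : realType} {X : completeNormedModType R} {W : Type}.
Variables (E : set cantor_space) (e : seq bool -> X) (k : W -> cantor_space).
Hypothesis k_bij : set_bij setT E k.
Hypothesis RK_covered : forall S : set (seq bool),
  RK (range e) (e @` S) <-> branch_covered E S.
Hypothesis E_infinite : infinite_set E.

Let family_mk T (F : set (set T)) A (FA : F A) : family_poset F :=
  exist _ A (mem_set FA).

Let covering (Q : set W) m : set (seq bool) :=
  [set s | (size s < m)%N \/ exists2 w, Q w & branch (k w) s].

Let covering_covered Q m : finite_set Q -> branch_covered E (covering Q m).
Proof.
move=> fQ; have /finite_seqP[F FE] := finite_image k fQ.
exists F, m; split.
  move=> x xF; have [w _ <-] : (k @` Q) x by rewrite FE.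
  by case: k_bij => kE _ _; exact: kE.
move=> s [sm|[w Qw ws]]; [by left|right].
by exists (k w) => //; have : [set` F] (k w) by rewrite -FE; exists w.
Qed.

Let RK_preimage (A : family_poset (RK (range e))) :
  e @` (e @^-1` val A) = val A.
Proof.
apply/seteqP; split; first exact: image_preimage_subset.
move=> y Ay; have [s _ sy] := (set_valP A).1 y Ay.
by exists s => //=; rewrite sy.
Qed.

Let finite_index (F : set cantor_space) : finite_set F -> finite_set (k @^-1` F).
Proof.
by apply: finite_preimage => x y _ _; case: k_bij => _ kI _; apply: kI; rewrite inE.
Qed.

Let index_of x : E x -> exists w, k w = x.
Proof. by case: k_bij => _ _ kE /kE[w _ wx]; exists w. Qed.

(** A relatively weakly compact set is covered by finitely many branches from [E] and
    the nodes shorter than some [m].  Encoding [m] as the first [m] points of a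
    sequence of distinct points of [E] gives the map to finite subsets; conversely, a
    finite set is sent to the union of its branches.  Both are Tukey functions, since
    a union of finitely many branches contains almost all of another branch only if
    that branch is one of them. *)
Lemma tukey_RK_finite_subsets :
  tukey_equiv (family_poset (RK (range e))) (family_poset (@finite_subsets W)).
Proof.
have [h h_inj hE] := infinite_set_injection E_infinite.
have RKc (A : family_poset (RK (range e))) : exists Fm : seq cantor_space * nat,
    (forall x, x \in Fm.1 -> E x) /\
    forall s, val A (e s) -> (size s < Fm.2)%N \/
      exists2 x, x \in Fm.1 & branch x s.
  have : RK (range e) (e @` (e @^-1` val A)) by rewrite RK_preimage; exact: set_valP.
  by move=> /RK_covered[F [m Fm]]; exists (F, m).
have [c cP] := choice RKc; split.
- pose q A := k @^-1` ([set` (c A).1] `|` h @` [set i | (i < (c A).2)%N]).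
  have qfin A : finite_subsets (q A).
    apply: finite_index; rewrite finite_setU; split; first exact: finite_seq.
    exact/finite_image/finite_II.
  exists (fun A => family_mk (qfin A)) => Q.
  have fQ : finite_set (val Q) := set_valP Q.
  have [m mP] : exists m, forall i, (k @` val Q) (h i) -> (i < m)%N.
    apply: finite_set_nat_bounded; apply: finite_preimage (finite_image k fQ).
    by move=> i j _ _; exact: h_inj.
  exists (family_mk ((RK_covered _).2 (covering_covered m fQ))) => A.
  move=> /family_poset_leE /= AQ; apply/family_poset_leE => /= y Ay.
  have [s _ sy] := (set_valP A).1 y Ay.
  exists s => //; rewrite -sy in Ay.
  have [cE cA] := cP A; have [sm|[x xF xs]] := cA s Ay; [left|right].
    have [w wh] := index_of (hE (size s)).
    apply: mP; exists w => //; apply: AQ.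
    by right; exists (size s).
  have [w wx] := index_of (cE _ xF).
  by exists w; rewrite ?wx//; apply: AQ; left; rewrite /= wx.
- exists (fun Q => family_mk ((RK_covered _).2 (covering_covered 0 (set_valP Q)))) => A.
  have [cE cA] := cP A.
  exists (family_mk (finite_index (finite_seq (c A).1))) => Q /family_poset_leE /= QA.
  apply/family_poset_leE => w /= Qw; apply/negPn/negP => /branch_separate[N NP].
  pose n := maxn N (c A).2.
  have Aw : val A (e (mkseq (k w) n)).
    apply: QA; exists (mkseq (k w) n) => //.
    by right; exists w => //; exact: branch_mkseq.
  have [|[y yF]] := cA _ Aw; first by rewrite size_mkseq ltnNge leq_maxr.
  exact: NP yF (leq_maxl _ _).
Qed.

End tukey.

Local Open Scope card_scope.

Theorem theorem7p12 (R : realType) :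
  (exists E : set cantor_space, coanalytic_set E /\ E #= [set: omega1]) ->
  exists (X : completeNormedModType R) (B : set X),
    [/\ unconditional_basis B, normalized B &
        tukey_equiv (family_poset (RK B))
                    (family_poset (@finite_subsets omega1))].
Proof.
move=> [E [/analytic_closed_image[Z [f [Zc fc fE]]] Ecard]].
pose A := tree_family Z f.
have hA := @tree_family_hereditary Z f.
have sA := @tree_family_singleton Z f.
exists (family_space R A), (range (@basis_vector R _ A)); split.
- split; last exact: closure_linear_span_basis.
  split.
  + rewrite (eq_finite_set (inj_card_eq (in2W (basis_vector_inj hA sA)))) => fN.
    exact: infinite_range (@mkseq_inj xpredT) (sub_finite_set (@subsetT _ _) fN).
  + exact: card_le_trans (card_image_le _ _) (countableP _).
  + by move=> _ [n _ <-]; rewrite -normr_gt0 normr_basis_vector.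
  + by exists 1 => // F G a GF FB; rewrite mul1r; exact: basis_unconditional.
- by move=> _ [n _ <-]; exact: normr_basis_vector.
- have /card_set_bijP[k kbij] : ([set: omega1] #= E)%card by rewrite card_eq_sym.
  apply: (@tukey_RK_finite_subsets R _ _ E _ k) => //.
  + by move=> S; exact: RK_tree_basis.
  + move=> /finite_set_countable; rewrite (eq_countable Ecard).
    exact: omega1_uncountable.
Qed.
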